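(* Let $\mathcal A=\{h_1,h_2,h_3,h_4,h_5\}$ be the arrangement in $\mathbb R^3$ of the planes spanned by the faces of a pyramid with a square base, where $h_5$ is the plane of the base and $h_1,h_2,h_3,h_4$ are the planes of the side faces in cyclic order, and let $V_q$ be its $23\times23$ $q$-Varchenko matrix, with the regions ordered as in the context. Then the Smith normal form of $V_q$ over $\mathbb Z[q]$ is $$\mathrm{diag}\big(1,\ (1-q^2)I_5,\ (1-q^2)^2I_{10},\ (1-q^2)^3I_6,\ (1-q^2)^2(1-q^8)\big),$$ with left transition matrix $WLTP$ and right transition matrix $(TP)^tRW^t$, i.e. $(WLTP)V_q((TP)^tRW^t)$ equals this diagonal matrix, where: $$P=\begin{pmatrix}I_9&-qI_9&0\\ 0&I_9&0\\ 0&0&I_5\end{pmatrix},\qquad T=\begin{pmatrix}1&0&0&0\\ -q\mathbf 1&I_4&0&0\\ q^2\mathbf 1&-q(I+J)&I_4&0\\ 0&0&0&U_2U_1\end{pmatrix}\ (\text{block sizes }1,4,4,14),$$ $$U_1=\begin{pmatrix}1&0&0&0&0\\ -q\mathbf 1&I_4&0&0&0\\ q^2\mathbf 1&-q(I+J)&I_4&0&0\\ 0&q^2J&-q(I+J)&I_4&0\\ -q^4&u_{41}&u_{42}&u_{43}&1\end{pmatrix}\ (\text{block sizes }1,4,4,4,1),$$ $u_{41}=(q^3,0,0,q^3)$, $u_{42}=(0,q^2,0,-q^2)$, $u_{43}=(-q,-q,0,0)$; $$U_2=\begin{pmatrix}I_9&0&0&0\\ 0&I_2&0&0\\ 0&-q^2I_2&I_2&0\\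 0&0&0&1\end{pmatrix},\quad L=\begin{pmatrix}I_{20}&0&0&0\\ 0&1&q^2&-q\\ 0&0&1&0\\ 0&-q&q^5&1+q^2\end{pmatrix},\quad R=\begin{pmatrix}I_{20}&0&0&0\\ 0&1&-q^4&q^5\\ 0&0&1&-q\\ 0&0&-q&1+q^2\end{pmatrix},$$ $$W=\begin{pmatrix}0&0&0&1&0&0&0&0\\ 1&0&0&0&0&0&0&0\\ 0&0&0&0&I_4&0&0&0\\ 0&I_4&0&0&0&0&0&0\\ 0&0&0&0&0&I_6&0&0\\ 0&0&I_4&0&0&0&0&0\\ 0&0&0&0&0&0&I_2&0\\ 0&0&0&0&0&0&0&1\end{pmatrix}\ (\text{column block sizes }1,4,4,1,4,6,2,1).$$ Here $\mathbf 1$ is the $4\times1$ column of ones, $I=I_4$, and $J$ is the $4\times4$ permutation matrix with $J_{r,r+1}=1$ for $1\le r\le3$, $J_{4,1}=1$ and all other entries $0$.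
   Context: For a hyperplane arrangement, the regions are the connected components of the complement of the union of the hyperplanes; $sep(R,R')$ is the set of hyperplanes separating $R$ from $R'$. The $q$-Varchenko matrix $V_q$ is indexed by the regions, with $(R,R')$-entry $q^{\#sep(R,R')}$. $R_0$ is the interior of the pyramid. A region $R$ is denoted by the string of indices of the planes in $sep(R_0,R)$ (with $0$ denoting $R_0$). The 23 regions, in order, are: first the nine regions on the side of $h_5$ not containing $R_0$: $5$; $15,25,35,45$; $125,235,345,145$; then the fourteen regions on the same side of $h_5$ as $R_0$: $0$; $1,2,3,4$; $12,23,34,41$; $123,234,341,412$; $1234$. A Smith normal form over $\mathbb Z[q]$ of an $m\times m$ matrix $M$ over $\mathbb Z[q]$ is a diagonal matrix $D=\mathrm{diag}(d_1,\dots,d_m)$ with $d_k\mid d_{k+1}$ in $\mathbb Z[q]$ for all $k$ and $D=AMB$ with $A,B\in GL_m(\mathbb Z[q])$; $A$ and $B$ are the left and right transition matrices. *)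

(* Defs.v *)
From mathcomp Require Import all_boot all_order all_algebra.
From mathcomp Require Import boolp classical_sets reals topology normedtype.

Set Implicit Arguments.
Unset Strict Implicit.
Unset Printing Implicit Defensive.

Import Order.TTheory GRing.Theory Num.Theory.
Import numFieldNormedType.Exports.

Local Open Scope classical_set_scope.
Local Open Scope ring_scope.

Section Geometry.
Variables (R : realType) (n : nat).
Implicit Types (x u v : 'rV[R]_n) (s : seq 'rV[R]_n) (C D : set 'rV[R]_n).

Definition dot u v : R := \sum_i u 0 i * v 0 i.

Definition aff_span s : set 'rV[R]_n :=
  [set x | exists c : 'I_(size s) -> R,
     \sum_i c i = 1 /\ x = \sum_i c i *: s`_i].

Definition conv_hull s : set 'rV[R]_n :=
  [set x | exists c : 'I_(size s) -> R,
     [/\ forall i, 0 <= c i, \sum_i c i = 1 & x = \sum_i c i *: s`_i]].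

(* H is a hyperplane with C and D in opposite open half-spaces; since (a, b)
   may be replaced by (- a, - b), one orientation suffices. *)
Definition separates (H C D : set 'rV[R]_n) : Prop :=
  exists (a : 'rV[R]_n) (b : R),
    [/\ a != 0, H = [set x | dot a x = b],
        C `<=` [set x | dot a x < b] & D `<=` [set x | b < dot a x]].

Variable I : finType.
Implicit Type h : I -> set 'rV[R]_n.

Definition regions h : set (set 'rV[R]_n) :=
  [set C | exists2 x, (~` \bigcup_k h k) x
         & C = connected_component (~` \bigcup_k h k) x].

(* Separating hyperplanes are recorded by their indices. *)
Definition sep h C D : {set I} := [set k | `[< separates (h k) C D >]].

Definition varchenko h m (reg : 'I_m -> set 'rV[R]_n) : 'M[{poly int}]_m :=
  \matrix_(i, j) 'X^#|sep h (reg i) (reg j)|.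

End Geometry.

(* The divisibility %| of {poly S} is only divisibility up to a scalar factor
   when S is not a field, so divisibility is spelled out in the ring S. *)
Definition is_smith_form (S : comUnitRingType) m (M D A B : 'M[S]_m) : Prop :=
  [/\ A \in unitmx, B \in unitmx, is_diag_mx D,
      forall i j : 'I_m, j = i.+1 :> nat -> exists c, D j j = D i i * c
    & D = A *m M *m B].

Section Pyramid.
Variable R : realType.
Implicit Types (v : 'I_4 -> 'rV[R]_3) (p : 'rV[R]_3).

(* v 0, v 1, v 2, v 3 are the consecutive vertices of a nondegenerate square. *)
Definition is_square v : Prop :=
  [/\ v 1 - v 0 = v 2 - v 3, v 1 != v 0,
      dot (v 1 - v 0) (v 3 - v 0) = 0
    & dot (v 1 - v 0) (v 1 - v 0) = dot (v 3 - v 0) (v 3 - v 0)].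

Definition is_square_pyramid v p : Prop :=
  is_square v /\ ~ aff_span (codom v) p.

(* Indices are shifted by one: h_1, ..., h_4 are the values at 0, ..., 3 (the
   side face at index i has vertices p, v i, v (i + 1 mod 4)) and h_5, the plane
   of the base, is the value at ord_max. *)
Definition pyramid_planes v p (k : 'I_5) : set 'rV[R]_3 :=
  if unlift ord_max k is Some i then aff_span [:: p; v i; v (ordS i)]
  else aff_span (codom v).

Definition pyramid_interior v p : set 'rV[R]_3 :=
  interior (conv_hull (p :: codom v)).

End Pyramid.

Definition region_strings : seq (seq nat) :=
  [:: [:: 5];
      [:: 1; 5]; [:: 2; 5]; [:: 3; 5]; [:: 4; 5];
      [:: 1; 2; 5]; [:: 2; 3; 5]; [:: 3; 4; 5]; [:: 1; 4; 5];
      [::];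
      [:: 1]; [:: 2]; [:: 3]; [:: 4];
      [:: 1; 2]; [:: 2; 3]; [:: 3; 4]; [:: 4; 1];
      [:: 1; 2; 3]; [:: 2; 3; 4]; [:: 3; 4; 1]; [:: 4; 1; 2];
      [:: 1; 2; 3; 4]]%N.

(* The set of 0-based plane indices encoded by the i-th string. *)
Definition region_label (i : 'I_23) : {set 'I_5} :=
  [set k : 'I_5 | k.+1 \in nth [::] region_strings i].

(* reg lists every region exactly once, in the order of region_strings. *)
Definition pyramid_regions (R : realType) (v : 'I_4 -> 'rV[R]_3)
    (p : 'rV[R]_3) (reg : 'I_23 -> set 'rV[R]_3) : Prop :=
  let h := pyramid_planes v p in
  let R0 := pyramid_interior v p in
  [/\ regions h R0, injective reg, range reg = regions h
    & forall i, sep h R0 (reg i) = region_label i].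

Section Matrices.

Local Notation q := ('X : {poly int}).
Local Notation "[ 'row' A , .. , B , C ]" :=
  (row_mx A .. (row_mx B C) ..) (at level 0).
Local Notation "[ 'col' A , .. , B , C ]" :=
  (col_mx A .. (col_mx B C) ..) (at level 0).

Local Notation I_ n := (1%:M : 'M[{poly int}]_n).
Local Notation O_ m n := (0 : 'M[{poly int}]_(m, n)).
(* one-by-one block *)
Local Notation "<< x >>" := ((x)%:M : 'M[{poly int}]_1) (at level 0).

Definition ones : 'cV[{poly int}]_4 := const_mx 1.

Definition matJ : 'M[{poly int}]_4 := \matrix_(r, c) (c == ordS r)%:R.

Local Notation IJ := (1%:M + matJ).

Definition row4 (a b c d : {poly int}) : 'rV[{poly int}]_4 :=
  [row << a >>, << b >>, << c >>, << d >>].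

Definition matP : 'M[{poly int}]_23 :=
  [col [row I_ 9, - q *: I_ 9, O_ 9 5],
       [row O_ 9 9, I_ 9, O_ 9 5],
       [row O_ 5 9, O_ 5 9, I_ 5]].

Definition matU1 : 'M[{poly int}]_14 :=
  [col [row << 1 >>, O_ 1 4, O_ 1 4, O_ 1 4, O_ 1 1],
       [row - q *: ones, I_ 4, O_ 4 4, O_ 4 4, O_ 4 1],
       [row q ^+ 2 *: ones, - q *: IJ, I_ 4, O_ 4 4, O_ 4 1],
       [row O_ 4 1, q ^+ 2 *: matJ, - q *: IJ, I_ 4, O_ 4 1],
       [row << - q ^+ 4 >>, row4 (q ^+ 3) 0 0 (q ^+ 3),
            row4 0 (q ^+ 2) 0 (- q ^+ 2), row4 (- q) (- q) 0 0, << 1 >>]].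

Definition matU2 : 'M[{poly int}]_14 :=
  [col [row I_ 9, O_ 9 2, O_ 9 2, O_ 9 1],
       [row O_ 2 9, I_ 2, O_ 2 2, O_ 2 1],
       [row O_ 2 9, - q ^+ 2 *: I_ 2, I_ 2, O_ 2 1],
       [row O_ 1 9, O_ 1 2, O_ 1 2, << 1 >>]].

Definition matT : 'M[{poly int}]_23 :=
  [col [row << 1 >>, O_ 1 4, O_ 1 4, O_ 1 14],
       [row - q *: ones, I_ 4, O_ 4 4, O_ 4 14],
       [row q ^+ 2 *: ones, - q *: IJ, I_ 4, O_ 4 14],
       [row O_ 14 1, O_ 14 4, O_ 14 4, matU2 *m matU1]].

Definition matL : 'M[{poly int}]_23 :=
  [col [row I_ 20, O_ 20 1, O_ 20 1, O_ 20 1],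
       [row O_ 1 20, << 1 >>, << q ^+ 2 >>, << - q >>],
       [row O_ 1 20, << 0 >>, << 1 >>, << 0 >>],
       [row O_ 1 20, << - q >>, << q ^+ 5 >>, << 1 + q ^+ 2 >>]].

Definition matR : 'M[{poly int}]_23 :=
  [col [row I_ 20, O_ 20 1, O_ 20 1, O_ 20 1],
       [row O_ 1 20, << 1 >>, << - q ^+ 4 >>, << q ^+ 5 >>],
       [row O_ 1 20, << 0 >>, << 1 >>, << - q >>],
       [row O_ 1 20, << 0 >>, << - q >>, << 1 + q ^+ 2 >>]].

Definition matW : 'M[{poly int}]_23 :=
  [col [row O_ 1 1, O_ 1 4, O_ 1 4, I_ 1, O_ 1 4, O_ 1 6, O_ 1 2, O_ 1 1],
       [row I_ 1, O_ 1 4, O_ 1 4, O_ 1 1, O_ 1 4, O_ 1 6, O_ 1 2, O_ 1 1],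
       [row O_ 4 1, O_ 4 4, O_ 4 4, O_ 4 1, I_ 4, O_ 4 6, O_ 4 2, O_ 4 1],
       [row O_ 4 1, I_ 4, O_ 4 4, O_ 4 1, O_ 4 4, O_ 4 6, O_ 4 2, O_ 4 1],
       [row O_ 6 1, O_ 6 4, O_ 6 4, O_ 6 1, O_ 6 4, I_ 6, O_ 6 2, O_ 6 1],
       [row O_ 4 1, O_ 4 4, I_ 4, O_ 4 1, O_ 4 4, O_ 4 6, O_ 4 2, O_ 4 1],
       [row O_ 2 1, O_ 2 4, O_ 2 4, O_ 2 1, O_ 2 4, O_ 2 6, I_ 2, O_ 2 1],
       [row O_ 1 1, O_ 1 4, O_ 1 4, O_ 1 1, O_ 1 4, O_ 1 6, O_ 1 2, I_ 1]].

Definition smith_diag : 'M[{poly int}]_23 :=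
  diag_mx [row (const_mx 1 : 'rV_1),
               (const_mx (1 - q ^+ 2) : 'rV_5),
               (const_mx ((1 - q ^+ 2) ^+ 2) : 'rV_10),
               (const_mx ((1 - q ^+ 2) ^+ 3) : 'rV_6),
               (const_mx ((1 - q ^+ 2) ^+ 2 * (1 - q ^+ 8)) : 'rV_1)].

Definition left_transition : 'M[{poly int}]_23 :=
  matW *m matL *m matT *m matP.

Definition right_transition : 'M[{poly int}]_23 :=
  (matT *m matP)^T *m matR *m matW^T.

End Matrices.

(* Main.v *)
Require Import Defs.
From mathcomp Require Import all_boot all_order all_algebra.
From mathcomp Require Import boolp classical_sets reals topology normedtype.
From mathcomp Require Import ring lra.

(* Each plane is the zero set of an affine form, and the connected component of
   a point of the complement is the set of points where all forms have the same
   signs as at that point: such a cell is convex, and on a connected set that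
   avoids the planes no form changes sign.  Hence the regions are the nonempty
   cells, and the planes separating two of them are exactly those whose forms
   have different signs on them.  In affine coordinates with the apex as origin
   and the base vertices at (+-1, +-1, 1), 23 of the 32 sign patterns are
   realized, so V_q is the matrix of the q^#(S Delta T) over the given labels
   S, T, and what remains is an identity between explicit polynomial matrices,
   checked by computing with lists of coefficients. *)

Set Implicit Arguments.
Unset Strict Implicit.
Unset Printing Implicit Defensive.

Import Order.TTheory GRing.Theory Num.Theory.
Import numFieldNormedType.Exports.

Local Open Scope ring_scope.

(** * Polynomial matrices as functions into coefficient lists *)

Section SeqPoly.
Variable S : comNzRingType.
Implicit Types s t : seq S.

Fixpoint addsp s t : seq S :=
  match s, t with
  | [::], _ => t
  | _, [::] => s
  | x :: s', y :: t' => x + y :: addsp s' t'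
  end.

Definition mulsp s t : seq S :=
  foldr (fun x r => addsp [seq x * y | y <- t] (0 :: r)) [::] s.

Definition oppsp s : seq S := map -%R s.

Definition expsp s n : seq S := iter n (mulsp s) [:: 1].

Lemma Poly_cons x s : Poly (x :: s) = Poly s * 'X + x%:P.
Proof. exact: cons_poly_def. Qed.

Lemma Poly_scale x s : Poly [seq x * y | y <- s] = x%:P * Poly s.
Proof.
elim: s => [|y s IHs]; first by rewrite mulr0.
by rewrite map_cons !Poly_cons IHs mulrDr mulrA polyCM.
Qed.

Lemma Poly_add s t : Poly (addsp s t) = Poly s + Poly t.
Proof.
elim: s t => [|x s IHs] [|y t]; rewrite ?add0r ?addr0 //.
by rewrite [addsp _ _]/= !Poly_cons IHs polyCD mulrDl addrACA.
Qed.

Lemma Poly_mul s t : Poly (mulsp s t) = Poly s * Poly t.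
Proof.
elim: s => [|x s IHs]; first by rewrite mul0r.
rewrite [mulsp _ _]/= Poly_add Poly_scale !Poly_cons IHs addr0.
by rewrite mulrDl addrC mulrAC.
Qed.

Lemma Poly_opp s : Poly (oppsp s) = - Poly s.
Proof.
elim: s => [|x s IHs]; first by rewrite oppr0.
by rewrite [oppsp _]/= !Poly_cons IHs polyCN opprD mulNr.
Qed.

Lemma Poly_exp s n : Poly (expsp s n) = Poly s ^+ n.
Proof.
elim: n => [|n IHn]; first by rewrite Poly_cons mul0r add0r.
by rewrite exprS -IHn -Poly_mul.
Qed.

Lemma Poly_foldr_add (I : Type) (r : seq I) (F : I -> seq S) :
  Poly (foldr (fun i => addsp (F i)) [::] r) = \sum_(i <- r) Poly (F i).
Proof. by elim: r => [|i r IHr]; rewrite ?big_nil ?big_cons //= Poly_add IHr. Qed.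

Lemma Poly_eq0 s : all (pred1 0) s -> Poly s = 0.
Proof.
elim: s => //= x s IHs /andP[/eqP -> /IHs].
by rewrite cons_poly_def => ->; rewrite mul0r add0r.
Qed.

End SeqPoly.

Section SeqMatrix.
Variable S : comNzRingType.
Local Notation entries := (nat -> nat -> seq S).
Implicit Types f g : entries.

Definition smx m n f : 'M[{poly S}]_(m, n) := \matrix_(i, j) Poly (f i j).

(** Coefficient lists run from degree 0 upwards and are not normalized, so two lists for one
    polynomial may differ by trailing zeros; the test is that every coefficient of the difference
    vanishes. *)
Definition eqsmx m n f g :=
  all (fun i => all (fun j => all (pred1 0) (addsp (f i j) (oppsp (g i j))))
                    (iota 0 n)) (iota 0 m).

Lemma eq_smx m n f g : eqsmx m n f g -> smx m n f = smx m n g.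
Proof.
move=> /allP fg; apply/matrixP => i j; rewrite !mxE.
have /fg/allP/(_ (val j)) : val i \in iota 0 m by rewrite mem_iota ltn_ord.
rewrite mem_iota ltn_ord => /(_ isT)/Poly_eq0.
by rewrite Poly_add Poly_opp => /subr0_eq.
Qed.

Definition rowf n f g : entries :=
  fun i j => if (j < n)%N then f i j else g i (j - n)%N.

Definition colf m f g : entries :=
  fun i j => if (i < m)%N then f i j else g (i - m)%N j.

Definition addf f g : entries := fun i j => addsp (f i j) (g i j).

Definition scalef s f : entries := fun i j => mulsp s (f i j).

Definition upperf f : entries := fun i j => if (i <= j)%N then f i j else [::].

Definition trf f : entries := fun i j => f j i.

(* Tabulating the product, and building every matrix operation from closures
   over evaluated arguments, makes vm_compute evaluate each entry of a nested
   product only once. *)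
Definition mulf m n p f g : entries :=
  let t := mkseq (fun i => mkseq (fun k =>
    foldr (fun j => addsp (mulsp (f i j) (g j k))) [::] (iota 0 n)) p) m in
  fun i k => nth [::] (nth [::] t i) k.

End SeqMatrix.

(** The polynomial or matrix is the input and its coefficient data the output: instance search
    follows the syntax of the expression and assembles a representation that evaluates. *)
Class reif_sp (S : comNzRingType) (p : {poly S}) (s : seq S) :=
  reif_spE : p = Poly s.
Class reif_mx (S : comNzRingType) m n (M : 'M[{poly S}]_(m, n)) f :=
  reif_mxE : M = smx m n f.
Arguments reif_spE {S} p {s _}.
Arguments reif_mxE {S m n} M {f _}.
Hint Mode reif_sp - ! - : typeclass_instances.
Hint Mode reif_mx - - - ! - : typeclass_instances.

Section ReifPoly.
Variable S : comNzRingType.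
Implicit Types (p : {poly S}) (s : seq S).

#[global] Instance reif_sp0 : @reif_sp S 0 [::].
Proof. by []. Qed.

#[global] Instance reif_sp1 : @reif_sp S 1 [:: 1].
Proof. by rewrite /reif_sp Poly_cons mul0r add0r. Qed.

#[global] Instance reif_spX : @reif_sp S 'X [:: 0; 1].
Proof. by rewrite /reif_sp !Poly_cons mul0r add0r mul1r addr0. Qed.

#[global] Instance reif_spD p1 p2 s1 s2 :
  reif_sp p1 s1 -> reif_sp p2 s2 -> reif_sp (p1 + p2) (addsp s1 s2).
Proof. by rewrite /reif_sp Poly_add => <- <-. Qed.

#[global] Instance reif_spN p s : reif_sp p s -> reif_sp (- p) (oppsp s).
Proof. by rewrite /reif_sp Poly_opp => <-. Qed.

#[global] Instance reif_spM p1 p2 s1 s2 :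
  reif_sp p1 s1 -> reif_sp p2 s2 -> reif_sp (p1 * p2) (mulsp s1 s2).
Proof. by rewrite /reif_sp Poly_mul => <- <-. Qed.

#[global] Instance reif_spXn p s n :
  reif_sp p s -> reif_sp (p ^+ n) (expsp s n).
Proof. by rewrite /reif_sp Poly_exp => <-. Qed.

End ReifPoly.

Section ReifMatrix.
Variable S : comNzRingType.
Implicit Types (p : {poly S}) (s : seq S) (f g : nat -> nat -> seq S).

#[global] Instance reif_mx0 m n : @reif_mx S m n 0 (fun _ _ => [::]).
Proof. by apply/matrixP => i j; rewrite !mxE. Qed.

#[global] Instance reif_const m n p s :
  reif_sp p s -> @reif_mx S m n (const_mx p) (fun _ _ => s).
Proof. by move=> ps; apply/matrixP => i j; rewrite !mxE. Qed.

#[global] Instance reif_scalar n p s :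
  reif_sp p s -> @reif_mx S n n p%:M (fun i j => if i == j then s else [::]).
Proof.
move=> ps; apply/matrixP => i j; rewrite !mxE -val_eqE.
by case: eqP => _; rewrite ?mulr1n ?mulr0n.
Qed.

#[global] Instance reif_diag n (d : 'rV[{poly S}]_n) f :
  reif_mx d f ->
  reif_mx (diag_mx d) (fun i j => if i == j then f 0 i else [::]).
Proof.
move=> ->; apply/matrixP => i j; rewrite !mxE -val_eqE.
by case: eqP => _; rewrite ?mulr1n ?mulr0n.
Qed.

#[global] Instance reif_add m n (M N : 'M[{poly S}]_(m, n)) f g :
  reif_mx M f -> reif_mx N g ->
  reif_mx (M + N) (addf f g).
Proof. by move=> -> ->; apply/matrixP => i j; rewrite !mxE Poly_add. Qed.

#[global] Instance reif_scale m n p s (M : 'M[{poly S}]_(m, n)) f :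
  reif_sp p s -> reif_mx M f ->
  reif_mx (p *: M) (scalef s f).
Proof. by move=> -> ->; apply/matrixP => i j; rewrite !mxE Poly_mul. Qed.

#[global] Instance reif_tr m n (M : 'M[{poly S}]_(m, n)) f :
  reif_mx M f -> reif_mx M^T (trf f).
Proof. by move=> ->; apply/matrixP => i j; rewrite !mxE. Qed.

Lemma reif_row m n1 n2 (M : 'M[{poly S}]_(m, n1))
    (N : 'M[{poly S}]_(m, n2)) f g :
  reif_mx M f -> reif_mx N g ->
  reif_mx (row_mx M N) (rowf n1 f g).
Proof.
move=> -> ->; apply/matrixP => i j; rewrite !mxE /rowf /colf; case: splitP => k ->.
  by rewrite mxE.
by rewrite mxE addKn.
Qed.

Lemma reif_col m1 m2 n (M : 'M[{poly S}]_(m1, n))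
    (N : 'M[{poly S}]_(m2, n)) f g :
  reif_mx M f -> reif_mx N g ->
  reif_mx (col_mx M N) (colf m1 f g).
Proof.
move=> -> ->; apply/matrixP => i j; rewrite !mxE /rowf /colf; case: splitP => k ->.
  by rewrite mxE.
by rewrite mxE addKn.
Qed.

#[global] Instance reif_mul m n r (M : 'M[{poly S}]_(m, n))
    (N : 'M[{poly S}]_(n, r)) f g :
  reif_mx M f -> reif_mx N g -> reif_mx (M *m N) (mulf m n r f g).
Proof.
move=> -> ->; apply/matrixP => i k; rewrite !mxE /mulf !nth_mkseq //.
rewrite Poly_foldr_add -[n in iota 0 n]subn0 big_mkord.
by apply: eq_bigr => j _; rewrite !mxE Poly_mul.
Qed.

End ReifMatrix.

(* The dimensions of a block matrix match its declared type only up to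
   conversion, which instance resolution does not see. *)
#[global] Hint Extern 0 (reif_mx (row_mx ?M ?N) _) =>
  refine (@reif_row _ _ _ _ M N _ _ _ _) : typeclass_instances.
#[global] Hint Extern 0 (reif_mx (col_mx ?M ?N) _) =>
  refine (@reif_col _ _ _ _ M N _ _ _ _) : typeclass_instances.

(** * Smith normal form of the label matrix *)

Definition hamming_label (i j : nat) :=
  count (fun k => (k.+1 \in nth [::] region_strings i)
              (+) (k.+1 \in nth [::] region_strings j)) (iota 0 5).

(** The matrix V_q stripped of geometry: separating sets become symmetric differences of labels,
    counted on lists of numbers so that the entries can be computed. *)
Definition label_mx : 'M[{poly int}]_23 := \matrix_(i, j) 'X^(hamming_label i j).

#[local] Instance reif_label_mx :
  reif_mx label_mx (fun i j => expsp [:: 0; 1] (hamming_label i j)).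
Proof.
by apply/matrixP => i j; rewrite !mxE Poly_exp -(reif_spE 'X).
Qed.

#[local] Instance reif_matJ :
  reif_mx matJ (fun i j => if j == (i.+1 %% 4)%N then [:: 1] else [::]).
Proof.
apply/matrixP => i j; rewrite !mxE -val_eqE /=.
by case: eqP => _; rewrite -?(reif_spE 1).
Qed.

Lemma reif_mx_eq (S : comNzRingType) m n (M N : 'M[{poly S}]_(m, n)) f g
    (Mf : reif_mx M f) (Ng : reif_mx N g) :
  eqsmx m n f g -> M = N.
Proof. by rewrite Mf Ng; apply: eq_smx. Qed.

(** Once [upperf] discards what lies below the diagonal, agreement with the identity means lower
    triangular with unit diagonal, hence determinant 1. *)
Lemma unitriangular_reif_unitmx (S : idomainType) n (M : 'M[{poly S}]_n) f
    (Mf : reif_mx M f) :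
    eqsmx n n (upperf f) (fun i j => if i == j then [:: 1] else [::]) ->
  M \in unitmx.
Proof.
move=> /eq_smx/matrixP trigM; rewrite unitmxE det_trig ?big1 ?unitr1 //.
  move=> i _; move: (trigM i i).
  by rewrite Mf !mxE /upperf leqnn eqxx -(reif_spE 1).
apply/is_trig_mxP => i j ltij; move: (trigM i j).
by rewrite Mf !mxE /upperf (ltnW ltij) ltn_eqF.
Qed.

Section Unimodularity.

Local Notation q := ('X : {poly int}).
Local Notation "<< x >>" := (x%:M : 'M[{poly int}]_1) (at level 0).

Lemma matP_unit : matP \in unitmx.
Proof.
(* [matP] is upper triangular while the criterion is for lower triangular matrices. *)
rewrite -unitmx_tr /matP; apply: unitriangular_reif_unitmx.
by vm_compute.
Qed.

Lemma matT_unit : matT \in unitmx.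
Proof.
rewrite /matT /matU2 /matU1 /row4 /ones; apply: unitriangular_reif_unitmx.
by vm_compute.
Qed.

Lemma matW_unit : matW \in unitmx.
Proof.
(* A permutation matrix is inverted by its transpose. *)
have /mulmx1_unit[] // : matW *m matW^T = 1%:M.
by rewrite /matW; apply: reif_mx_eq; vm_compute.
Qed.

Lemma matL_unit : matL \in unitmx.
Proof.
(* [K] is the adjugate of the lower right 3 x 3 block of [matL], which has determinant 1; the same
   recipe serves for [matR]. *)
pose K : 'M[{poly int}]_3 := col_mx
  (row_mx << 1 + q ^+ 2 >> (row_mx << - q ^+ 2 - q ^+ 4 - q ^+ 6 >> << q >>))
  (col_mx (row_mx 0 (row_mx << 1 >> 0))
    (row_mx << q >> (row_mx << - q ^+ 3 - q ^+ 5 >> << 1 >>))).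
have /mulmx1_unit[] // :
  matL *m (col_mx (row_mx 1%:M 0) (row_mx 0 K) : 'M_(20 + 3)) = 1%:M.
by rewrite /matL /K; apply: reif_mx_eq; vm_compute.
Qed.

Lemma matR_unit : matR \in unitmx.
Proof.
pose K : 'M[{poly int}]_3 := col_mx
  (row_mx << 1 >> (row_mx << q ^+ 4 >> 0))
  (col_mx (row_mx 0 (row_mx << 1 + q ^+ 2 >> << q >>))
    (row_mx 0 (row_mx << q >> << 1 >>))).
have /mulmx1_unit[] // :
  matR *m (col_mx (row_mx 1%:M 0) (row_mx 0 K) : 'M_(20 + 3)) = 1%:M.
by rewrite /matR /K; apply: reif_mx_eq; vm_compute.
Qed.

End Unimodularity.

Lemma smith_diag_dvd (i j : 'I_23) :
  j = i.+1 :> nat -> exists c, smith_diag j j = smith_diag i i * c.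
Proof.
move=> ij; have lti : (i < 22)%N by rewrite -ltnS -ij ltn_ord.
rewrite /smith_diag [diag_mx _]reif_mxE.
set f := (f in smx _ _ f).
(* the ratios of consecutive diagonal entries, at the ends of the blocks *)
pose c (k : nat) : seq int := if k == 21%N then [:: 1; 0; 1; 0; 1; 0; 1]
  else if k \in [:: 0; 5; 15]%N then [:: 1; 0; -1] else [:: 1].
exists (Poly (c i)); rewrite !mxE -Poly_mul ij.
have /eq_smx/matrixP/(_ ord0 (Ordinal lti)) :
    eqsmx 1 22 (fun _ k => f k.+1 k.+1) (fun _ k => mulsp (f k k) (c k)).
  by vm_compute.
by rewrite !mxE.
Qed.

Lemma label_mx_smith_form :
  is_smith_form label_mx smith_diag left_transition right_transition.
Proof.
split.
- by rewrite !unitmx_mul matW_unit matL_unit matT_unit matP_unit.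
- by rewrite !unitmx_mul !unitmx_tr unitmx_mul matT_unit matP_unit
             matR_unit matW_unit.
- exact: diag_mx_is_diag.
- exact: smith_diag_dvd.
(* Unfolding exposes the block structure to instance search; [matJ] stays folded because it has an
   instance of its own. *)
- rewrite /left_transition /right_transition /smith_diag
    /matW /matL /matR /matT /matP /matU1 /matU2 /row4 /ones.
  by apply: reif_mx_eq; vm_compute.
Qed.

(** * Regions of an affine arrangement *)

Local Open Scope classical_set_scope.
Local Open Scope ring_scope.

Section AffineForms.
Variables (R : realType) (n : nat).
Implicit Types (a x y : 'rV[R]_n) (b t : R).

Definition aform a b x : R := dot a x - b.

Lemma dotDr a x y : dot a (x + y) = dot a x + dot a y.
Proof. by rewrite /dot -big_split; apply: eq_bigr => i _; rewrite mxE mulrDr. Qed.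

Lemma dotZr a t x : dot a (t *: x) = t * dot a x.
Proof.
by rewrite /dot mulr_sumr; apply: eq_bigr => i _; rewrite mxE mulrCA.
Qed.

Lemma dot0r a : dot a 0 = 0.
Proof. by rewrite -(scale0r 0) dotZr mul0r. Qed.

Lemma dotC x y : dot x y = dot y x.
Proof. by apply: eq_bigr => i _; rewrite mulrC. Qed.

Lemma dot_mulmx x y : dot x y = (y *m x^T) 0 0.
Proof. by rewrite mxE; apply: eq_bigr => i _; rewrite mxE mulrC. Qed.

Lemma dotNr a x : dot a (- x) = - dot a x.
Proof. by rewrite -scaleN1r dotZr mulN1r. Qed.

Lemma dotNl a x : dot (- a) x = - dot a x.
Proof. by rewrite dotC dotNr dotC. Qed.

Lemma dot_sumr a m (F : 'I_m -> 'rV[R]_n) :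
  dot a (\sum_i F i) = \sum_i dot a (F i).
Proof.
apply: (big_morph (dot a)) => [x y|]; first exact: dotDr.
exact: dot0r.
Qed.

Lemma dot_eq0 x : (dot x x == 0) = (x == 0).
Proof.
rewrite psumr_eq0 => [|i _]; last by rewrite -expr2 sqr_ge0.
apply/allP/eqP => [x0|-> i _]; last by rewrite mxE mul0r eqxx.
apply/rowP => i; apply/eqP; have := x0 i (mem_index_enum i).
by rewrite /= mulf_eq0 orbb mxE.
Qed.

Lemma aform_line a b x y t :
  aform a b (x + t *: (y - x)) = (1 - t) * aform a b x + t * aform a b y.
Proof. by rewrite /aform dotDr dotZr dotDr dotNr; ring. Qed.

Lemma aform_comb a b m (c : 'I_m -> R) (F : 'I_m -> 'rV[R]_n) :
  \sum_i c i = 1 -> aform a b (\sum_i c i *: F i) = \sum_i c i * aform a b (F i).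
Proof.
move=> c1; rewrite /aform dot_sumr -[b in LHS]mul1r -c1 mulr_suml -sumrB.
by apply: eq_bigr => i _; rewrite dotZr mulrBr.
Qed.

Lemma aform_continuous a b : continuous (aform a b).
Proof.
suff dot_cont : continuous (dot a).
  by move=> x; apply: continuousB; [exact: dot_cont | exact: cst_continuous].
rewrite /dot; elim: (index_enum _) => [|i s IHs].
  by under [fun=> _]funext do rewrite big_nil; exact: cst_continuous.
under [fun=> _]funext do rewrite big_cons.
move=> x; apply: continuousD (IHs x).
apply: continuousM; first exact: cst_continuous.
exact: coord_continuous.
Qed.

Lemma line_continuous x y : continuous (fun t => x + t *: (y - x)).
Proof.
move=> t; apply: (@continuousD _ _ _ (fun=> x) (fun t => t *: (y - x))).
  exact: cst_continuous.
exact: scalel_continuous.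
Qed.

Lemma segment_set_connected x y :
  connected [set x + t *: (y - x) | t in `[0, 1]%classic].
Proof.
apply: connected_continuous_connected; first exact: segment_connected.
exact/continuous_subspaceT/line_continuous.
Qed.

End AffineForms.

Section Cells.
Variables (R : realType) (n : nat) (I : finType).
Variables (a : I -> 'rV[R]_n) (b : I -> R).
Implicit Types (x y : 'rV[R]_n) (S T : {set I}).

Local Notation l k := (aform (a k) (b k)).

Definition planes k : set 'rV[R]_n := [set x | dot (a k) x = b k].

Definition cell S : set 'rV[R]_n :=
  [set x | forall k, 0 < (-1) ^+ (k \in S) * l k x].

Definition negset x : {set I} := [set k | l k x < 0]%SET.

Lemma planesE k x : planes k x <-> l k x = 0.
Proof. by rewrite /aform; split=> [->|/subr0_eq//]; rewrite subrr. Qed.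

Lemma cell_sub S : cell S `<=` ~` \bigcup_k planes k.
Proof.
move=> x Sx [k _ /planesE lx0].
by have := Sx k; rewrite lx0 mulr0 ltxx.
Qed.

Lemma cell_negset S x : cell S x -> S = negset x.
Proof.
move=> Sx; apply/setP => k; rewrite inE; have := Sx k.
by case: (k \in S); [rewrite mulN1r oppr_gt0 => -> | rewrite mul1r => /lt_gtF].
Qed.

Lemma negset_cell x : (~` \bigcup_k planes k) x -> cell (negset x) x.
Proof.
move=> x_out k; have lx0 : l k x != 0.
  by apply/eqP => /planesE lx0; apply: x_out; exists k.
rewrite inE; case: (ltgtP (l k x) 0) lx0 => // lx _; last by rewrite mul1r.
by rewrite mulN1r oppr_gt0.
Qed.

Lemma cell_line S x y t :
  cell S x -> cell S y -> 0 <= t <= 1 -> cell S (x + t *: (y - x)).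
Proof.
move=> Sx Sy /andP[t0 t1] k; rewrite aform_line.
have := Sx k; have := Sy k; case: (k \in S); rewrite ?mulN1r ?mul1r; nra.
Qed.

(** The image of [C] under the form is an interval; a value that is not positive would force 0 into
    it, and so a point of [C] onto the plane. *)
Lemma connected_aform_gt0 (C : set 'rV[R]_n) x y k :
    connected C -> C `<=` ~` planes k -> C x -> C y ->
  0 < l k x -> 0 < l k y.
Proof.
move=> Cc Ck Cx Cy lx; rewrite ltNge; apply/negP => ly.
have /connected_intervalP/(_ (l k y) (l k x)) : connected (l k @` C).
  apply: connected_continuous_connected Cc _.
  exact/continuous_subspaceT/aform_continuous.
move=> /(_ _ _ 0)[]; [by exists y | by exists x | by rewrite ly ltW|].
by move=> z Cz lz; apply: (Ck z Cz); apply/planesE.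
Qed.

Lemma component_cell x : (~` \bigcup_k planes k) x ->
  connected_component (~` \bigcup_k planes k) x = cell (negset x).
Proof.
move=> x_out; apply/seteqP; split=> y; last first.
  move=> xy; have seg01 := @segment_set_connected R n x y.
  apply: (connected_component_max _ _ seg01).
  - by exists 0; rewrite /= ?in_itv /= ?lexx ?ler01 // scale0r addr0.
  - move=> _ [t t01 <-]; apply: cell_sub (cell_line (negset_cell x_out) xy _).
    by move: t01; rewrite /= in_itv.
  - by exists 1; rewrite /= ?in_itv /= ?lexx ?ler01 // scale1r addrC subrK.
move=> [C [Cx Csub Cc] Cy].
(* Here [C] is a connected set through [x] and [y] that avoids the planes, so every form has the
   same sign at both points. *)
suff -> : negset x = negset y by apply: negset_cell; exact: Csub.
apply/setP => k; have Ck : C `<=` ~` planes k.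
  by move=> z Cz kz; apply: (Csub z Cz); exists k.
have l_lt0 z : C z -> (l k z < 0) = ~~ (0 < l k z).
  by move=> Cz; case: ltgtP => // /planesE /(Ck z Cz).
rewrite !inE !l_lt0 //; congr (~~ _).
by apply/idP/idP; [exact: connected_aform_gt0 Cc Ck Cx Cy
                  |exact: connected_aform_gt0 Cc Ck Cy Cx].
Qed.

Lemma regions_cells :
  regions planes = [set C | exists2 S, cell S !=set0 & C = cell S].
Proof.
apply/seteqP; split=> C.
  move=> [x x_out ->]; exists (negset x); last exact: component_cell.
  by exists x; exact: negset_cell.
move=> [S [x Sx] ->]; exists x; first exact: cell_sub Sx.
by rewrite component_cell ?(cell_negset Sx) //; exact: cell_sub Sx.
Qed.

(** A point of a cell recovers the label as its set of negative forms; different labels may share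
    the empty cell. *)
Lemma cell_inj S T : cell S !=set0 -> cell S = cell T -> S = T.
Proof.
by move=> [x Sx] ST; rewrite (cell_negset Sx); rewrite ST in Sx; apply/esym/cell_negset.
Qed.

(** If [k] lies in both labels or in neither, the k-th form keeps its sign on a segment joining the
    two cells, whereas a separating plane has to meet that segment. Otherwise the form itself, up to
    sign, separates. *)
Lemma sep_cell S T :
    (forall k, a k != 0) -> cell S !=set0 -> cell T !=set0 ->
  sep planes (cell S) (cell T) = [set k | (k \in S) (+) (k \in T)]%SET.
Proof.
move=> a0 [x Sx] [y Ty]; apply/setP => k; rewrite !inE; apply/asboolP/idP.
  move=> [c [d [c0 kE cx dy]]]; apply/negPn/negP => ST.
  have {ST}Tk : (k \in T) = (k \in S) by move: ST; do 2!case: (k \in _).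
  have := cx _ Sx; have := dy _ Ty => /= {}dy {}cx.
  have den0 : 0 < dot c y - dot c x by lra.
  (* The parameter at which the segment from [x] to [y] crosses the hyperplane [dot c = d]. *)
  pose t := (d - dot c x) / (dot c y - dot c x).
  have t0 : 0 <= t by apply: divr_ge0; lra.
  have t1 : t <= 1 by rewrite ler_pdivrMr //; lra.
  have : planes k (x + t *: (y - x)).
    rewrite kE /= dotDr dotZr dotDr dotNr /t divfK ?gt_eqF //; ring.
  move=> /planesE; rewrite aform_line.
  have := Sx k; have := Ty k; rewrite Tk.
  by case: (k \in S); rewrite ?mulN1r ?mul1r; nra.
case: (boolP (k \in S)) => kS /= kT.
- exists (a k), (b k); split=> // z.
    by move=> /(_ k); rewrite kS mulN1r oppr_gt0 subr_lt0.
  by move=> /(_ k); rewrite (negPf kT) mul1r subr_gt0.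
- exists (- a k), (- b k); split=> [||z|z].
  + by rewrite oppr_eq0.
  + by apply/seteqP; split=> z /=; rewrite dotNl; [move=> -> | move/oppr_inj].
  + by move=> /(_ k); rewrite (negPf kS) mul1r subr_gt0 /= dotNl ltrN2.
  + by move=> /(_ k); rewrite kT mulN1r oppr_gt0 subr_lt0 /= dotNl ltrN2.
Qed.

Lemma in_cell0 x : cell finset.set0 x <-> forall k, 0 < l k x.
Proof. by split=> + k => /(_ k); rewrite inE mul1r. Qed.

Lemma interior_cell0 (A : set 'rV[R]_n) :
    cell finset.set0 !=set0 -> cell finset.set0 `<=` A ->
    (forall x k, A x -> 0 <= l k x) ->
  interior A = cell finset.set0.
Proof.
move=> [y y0] cell_A A_ge0; apply/seteqP; split=> x; last first.
  move=> x0; have x_gt0 : \forall z \near x, forall k, 0 < l k z; last first.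
    by apply: filterS x_gt0 => z /in_cell0 /cell_A.
  apply: (@filter_forall _ _ (fun k z => 0 < l k z) (nbhs x) _) => k.
  apply: (@aform_continuous _ _ (a k) (b k) x [set t | 0 < t]).
  exact: lt_nbhsr ((in_cell0 x).1 x0 k).
move=> Ax; apply/in_cell0 => k; have ly := (in_cell0 y).1 y0 k.
have : nbhs (x + 0 *: (y - x)) A by rewrite scale0r addr0.
(* Stepping from [x] slightly away from [y] stays in [A], where the form is nonnegative; as it is
   positive at [y], it must already be positive at [x]. *)
move=> /(@line_continuous _ _ x y 0)/nbhs_ballP[e /= e0 /(_ (- (e / 2)))].
have e20 : 0 < e / 2 by rewrite divr_gt0.
rewrite /ball /= sub0r opprK gtr0_norm // ltr_pdivrMr // => /(_ _)/A_ge0.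
have e2e : e < e * 2 by lra.
move=> /(_ k e2e); rewrite aform_line; nra.
Qed.

End Cells.

(** * The square pyramid *)

Lemma big_ord3 (V : zmodType) (F : 'I_3 -> V) :
  \sum_i F i = F 0 + F 1 + F 2.
Proof.
rewrite !big_ord_recr big_ord0 /= add0r.
by congr (F _ + F _ + F _); apply/val_inj.
Qed.

Section Frame.
Variables (R : realType) (p : 'rV[R]_3) (M : 'M[R]_3).
Hypothesis M_unit : M \in unitmx.

Definition frame_pt (s t z : R) : 'rV[R]_3 :=
  p + (s *: row 0 M + t *: row 1 M + z *: row 2 M).

(* In the frame with origin at the apex and base vertices (-1,-1,1), (1,-1,1),
   (1,1,1), (-1,1,1), the pyramid is the set where the forms z + t, z - s,
   z - t, z + s and 1 - z are positive; an entry lists the coefficients of s,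
   t, z and the constant term. *)
Definition face_coef (k : 'I_5) : seq R :=
  nth [::] [:: [:: 0; 1; 1; 0]; [:: -1; 0; 1; 0]; [:: 0; -1; 1; 0];
               [:: 1; 0; 1; 0]; [:: 0; 0; -1; 1]] k.

(** Chosen so that its dot products with the rows of [M] are the first three coefficients; [offset]
    then gives the form the constant term as its value at the apex. *)
Definition normal k : 'rV[R]_3 := (invmx M *m \col_i (face_coef k)`_i)^T.

Definition offset k : R := dot (normal k) p - (face_coef k)`_3.

Lemma frame_pt_onto x : exists s t z, x = frame_pt s t z.
Proof.
pose y := (x - p) *m invmx M; exists (y 0 0), (y 0 1), (y 0 2).
rewrite /frame_pt -[x in LHS](subrK p) addrC; congr (_ + _).
by rewrite -[LHS](mulmxKV M_unit) -/y mulmx_sum_row big_ord3.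
Qed.

Lemma aform_frame_pt k s t z :
  aform (normal k) (offset k) (frame_pt s t z) =
  s * (face_coef k)`_0 + t * (face_coef k)`_1 + z * (face_coef k)`_2 + (face_coef k)`_3.
Proof.
have dot_row i : dot (normal k) (row i M) = (face_coef k)`_i.
  by rewrite dot_mulmx trmxK mulmxA -!row_mul mulmxV // mul1mx !mxE.
rewrite /aform /offset /frame_pt !dotDr !dotZr !dot_row /=; ring.
Qed.

Lemma normal_neq0 k : normal k != 0.
Proof.
rewrite -trmx0 (inj_eq trmx_inj) -(mulmx0 _ (invmx M)).
rewrite (inj_eq (can_inj (mulKVmx M_unit))).
apply/eqP => /colP c0; have := c0 0; have := c0 1; have := c0 2; rewrite !mxE.
by case: k {c0} => -[|[|[|[|[|//]]]]] ? /= /eqP + /eqP + /eqP;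
   rewrite ?oppr_eq0 ?oner_eq0.
Qed.

End Frame.

Lemma codom_ord4 (T : Type) (v : 'I_4 -> T) : codom v = [:: v 0; v 1; v 2; v 3].
Proof.
rewrite codomE /= !enum_ordSl (size0nil (size_enum_ord 0)) /=.
by congr [:: v _; v _; v _; v _]; apply/val_inj.
Qed.

Lemma square_pyramid_frame (R : realType) (v : 'I_4 -> 'rV[R]_3) p :
  is_square_pyramid v p ->
  exists2 M, M \in unitmx &
    [/\ v 0 = frame_pt p M (-1) (-1) 1, v 1 = frame_pt p M 1 (-1) 1,
        v 2 = frame_pt p M 1 1 1 & v 3 = frame_pt p M (-1) 1 1].
Proof.
move=> [[par v10 perp iso] p_out].
(* Half-sides of the base, followed by the vector from the apex to the centre of the base. *)
pose e1 := 2^-1 *: (v 1 - v 0); pose e2 := 2^-1 *: (v 3 - v 0).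
pose e3 := 2^-1 *: (v 0 + v 2) - p.
pose M := \matrix_(i < 3) [:: e1; e2; e3]`_i.
have v2E : v 2 = v 1 - v 0 + v 3 by rewrite par subrK.
have row_M i : row i M = [:: e1; e2; e3]`_i by rewrite rowK.
exists M; last first.
  rewrite /frame_pt !row_M /= /e1 /e2 /e3 v2E.
  by split; apply/rowP => i; rewrite !mxE; field.
rewrite -row_free_unit; apply: inj_row_free => u.
rewrite mulmx_sum_row big_ord3 !row_M /=.
have e12 : dot e1 e2 = 0 by rewrite dotZr dotC dotZr dotC perp !mulr0.
have e11 : dot e1 e1 != 0.
  by rewrite dot_eq0 scaler_eq0 invr_eq0 pnatr_eq0 subr_eq0.
have e22 : dot e2 e2 = dot e1 e1.
  by rewrite !dotZr ![dot (_ *: _) _]dotC !dotZr iso.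
(* A relation without [e3] is killed by pairing with the orthogonal nonzero vectors [e1] and [e2];
   one that involves [e3] can be solved for [p], placing the apex in the base plane. *)
have [u2|u2] := eqVneq (u 0 2) 0.
  rewrite u2 scale0r addr0 => E.
  have := congr1 (dot e1) E; have := congr1 (dot e2) E.
  rewrite !dotDr ![dot _ (u 0 _ *: _)]dotZr [dot e2 e1]dotC e12 e22 !dot0r.
  rewrite !mulr0 add0r addr0 => /eqP + /eqP; rewrite !mulf_eq0 (negPf e11) !orbF.
  move=> /eqP u1 /eqP u0; apply/rowP => i.
  by rewrite mxE; case: i => -[|[|[|//]]] ?; [rewrite -[RHS]u0|rewrite -[RHS]u1|
    rewrite -[RHS]u2]; congr (u _ _); apply/val_inj.
move=> /(congr1 ( *:%R (u 0 2)^-1)); rewrite scaler0 !scalerDr !scalerA mulVf //.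
rewrite scale1r; set r1 := _ * _; set r2 := _ * _ => E; case: p_out.
rewrite codom_ord4.
exists (fun i => [:: 2^-1 - r1 - r2; r1; 2^-1; r2]`_i).
rewrite /= !big_ord_recr !big_ord0 /=; split; first by field.
apply/rowP => i; have := congr1 (fun w : 'rV_3 => w 0 i) E.
by rewrite /= /e1 /e2 /e3 !mxE => Ei; lra.
Qed.

Local Notation face k := (@Ordinal 5 k isT).

Lemma forall_ord5 (P : 'I_5 -> Prop) :
  P (face 0) -> P (face 1) -> P (face 2) ->
  P (face 3) -> P (face 4) -> forall k, P k.
Proof.
move=> P0 P1 P2 P3 P4 [k ltk5].
by case: k ltk5 => [|[|[|[|[|//]]]]] ltk5;
   rewrite (bool_irrelevance ltk5 isT).
Qed.

Lemma aff_span_planes (R : realType) n (I : finType) (a : I -> 'rV[R]_n) b k s :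
    (forall x, x \in s -> aform (a k) (b k) x = 0) ->
  aff_span s `<=` planes a b k.
Proof.
move=> s0 x [c [c1 ->]]; apply/planesE; rewrite aform_comb //.
by rewrite big1 // => i _; rewrite s0 ?mulr0 // mem_nth.
Qed.

Lemma conv_hull_ge0 (R : realType) n (a : 'rV[R]_n) b s x :
    (forall x, x \in s -> 0 <= aform a b x) ->
  conv_hull s x -> 0 <= aform a b x.
Proof.
move=> s0 [c [c0 c1 ->]]; rewrite aform_comb //.
by apply: sumr_ge0 => i _; rewrite mulr_ge0 // s0 // mem_nth.
Qed.

(** * Planes, interior and nonempty cells of the pyramid arrangement *)

Section PyramidCells.
Variables (R : realType) (v : 'I_4 -> 'rV[R]_3) (p : 'rV[R]_3) (M : 'M[R]_3).
Hypothesis M_unit : M \in unitmx.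
Hypothesis vE : forall i : 'I_4,
  v i = frame_pt p M [:: -1; 1; 1; -1]`_i [:: -1; -1; 1; 1]`_i 1.

Local Notation l k := (aform (normal M k) (offset p M k)).
Local Notation pcell := (cell (normal M) (offset p M)).

Lemma apexE : p = frame_pt p M 0 0 0.
Proof. by rewrite /frame_pt !scale0r !addr0. Qed.

Lemma aform_apex k : l k p = (face_coef R k)`_3.
Proof. by rewrite [X in aform _ _ X]apexE aform_frame_pt // !mul0r !add0r. Qed.

Lemma pyramid_planesE : pyramid_planes v p = planes (normal M) (offset p M).
Proof.
apply/funext => k; rewrite /pyramid_planes.
case: unliftP => [i ->|->] /=; apply/seteqP; split.
- apply: aff_span_planes => x; rewrite !inE => /or3P[]/eqP ->.
  + by rewrite aform_apex; case: i => -[|[|[|[|//]]]] ?.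
  + by rewrite vE aform_frame_pt //; case: i => -[|[|[|[|//]]]] ? /=; ring.
  + by rewrite vE aform_frame_pt //; case: i => -[|[|[|[|//]]]] ? /=; ring.
- move=> x /planesE; have [s [t [z ->]]] := frame_pt_onto p M_unit x.
  rewrite aform_frame_pt // => lx.
  (* At level [z] the side plane is cut in the line through the base edge scaled by [z], of length
     [2 z]; [c] is the coordinate along it from the scaled vertex [v i]. *)
  pose c := [:: s + z; t + z; z - s; z - t]`_i.
  exists (fun j => [:: 1 - z; z - c / 2; c / 2]`_j).
  rewrite /= !big_ord_recr !big_ord0 /=; split; first by ring.
  rewrite [in RHS]apexE !vE {}/c.
  apply/rowP => j; case: i lx => -[|[|[|[|//]]]] ? /= lx; rewrite !mxE.
  + have -> : t = - z by lra.
    by field.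
  + have -> : s = z by lra.
    by field.
  + have -> : t = z by lra.
    by field.
  + have -> : s = - z by lra.
    by field.
- rewrite codom_ord4; apply: aff_span_planes => x.
  by rewrite !inE => /or4P[]/eqP ->; rewrite vE aform_frame_pt //=; ring.
- move=> x /planesE; have [s [t [z ->]]] := frame_pt_onto p M_unit x.
  rewrite aform_frame_pt // codom_ord4 => /= lx.
  (* Coordinates from the corner [v 0] along its two sides; [v 2] gets weight 0. *)
  exists (fun j => [:: - (s + t) / 2; (s + 1) / 2; 0; (t + 1) / 2]`_j).
  rewrite /= !big_ord_recr !big_ord0 /=; split; first by field.
  have -> : z = 1 by lra.
  by rewrite !vE; apply/rowP => j; rewrite !mxE /=; field.
Qed.

(** By [interior_cell0] it suffices that all forms are nonnegative at the five vertices, hence on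
    the hull, and that the hull contains the positive cell. *)
Lemma pyramid_interiorE :
  pcell finset.set0 !=set0 -> pyramid_interior v p = pcell finset.set0.
Proof.
move=> cell0; apply: interior_cell0 => // [x|x k]; rewrite codom_ord4; last first.
  apply: conv_hull_ge0 => y; rewrite !inE => /orP[/eqP->|/or4P[]/eqP->];
    rewrite ?aform_apex ?vE ?aform_frame_pt //;
    move: k; apply: forall_ord5 => /=; lra.
have [s [t [z ->]]] := frame_pt_onto p M_unit x => /in_cell0 l_gt0.
have := l_gt0 (face 0); have := l_gt0 (face 1).
have := l_gt0 (face 2); have := l_gt0 (face 3).
have := l_gt0 (face 4); rewrite !aform_frame_pt //= => l5 l4 l3 l2 l1.
have z0 : 0 < z by lra.
(* bilinear interpolation in the square at height z *)
exists (fun j => [:: 1 - z; (z - s) * (z - t) / (4 * z);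
  (z + s) * (z - t) / (4 * z); (z + s) * (z + t) / (4 * z);
  (z - s) * (z + t) / (4 * z)]`_j).
split=> [[[|[|[|[|[|//]]]]] ?] /=||]; first lra.
- by rewrite divr_ge0 ?mulr_ge0 //; lra.
- by rewrite divr_ge0 ?mulr_ge0 //; lra.
- by rewrite divr_ge0 ?mulr_ge0 //; lra.
- by rewrite divr_ge0 ?mulr_ge0 //; lra.
- by rewrite /= !big_ord_recr !big_ord0 /=; field; rewrite gt_eqF.
rewrite /= !big_ord_recr !big_ord0 /= !vE [in RHS]apexE.
by apply/rowP => j; rewrite !mxE /=; field; rewrite gt_eqF.
Qed.

(* The forms satisfy l_1 + l_3 = l_2 + l_4 = 2 z = 2 (1 - l_5): beyond the base
   (z > 1) two opposite faces are never both crossed, and below the apex (z < 0)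
   each pair of opposite faces has one that is crossed. *)
Definition realizable (S : {set 'I_5}) :=
  let b0 := face 0 \in S in let b1 := face 1 \in S in
  let b2 := face 2 \in S in let b3 := face 3 \in S in
  if face 4 \in S then ~~ (b0 && b2) && ~~ (b1 && b3)
  else (b0 && b2 ==> b1 || b3) && (b1 && b3 ==> b0 || b2).

Lemma pcell_realizable S : pcell S !=set0 <-> realizable S.
Proof.
rewrite /realizable; split.
  move=> [x]; have [s [t [z ->]]] := frame_pt_onto p M_unit x => l_gt0.
  have := l_gt0 (face 0); have := l_gt0 (face 1).
  have := l_gt0 (face 2); have := l_gt0 (face 3).
  have := l_gt0 (face 4); rewrite !aform_frame_pt //=.
  do 5!case: (_ \in S); rewrite ?mulN1r ?mul1r //=; lra.
move=> realS.
(* Each horizontal coordinate moves by 3 towards a crossed face, and opposite moves cancel. As 3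
   exceeds the absolute value of every level used, an unbalanced pair of faces gets its signs from
   the move, a balanced pair from the sign of the level: 2 beyond the base, -1 if an opposite pair
   is crossed, 1/2 otherwise. *)
exists (frame_pt p M
  (3 * (face 1 \in S)%:R - 3 * (face 3 \in S)%:R)
  (3 * (face 2 \in S)%:R - 3 * (face 0 \in S)%:R)
  (if face 4 \in S then 2
   else if (face 0 \in S) && (face 2 \in S)
        || (face 1 \in S) && (face 3 \in S)
   then -1 else 2^-1)).
apply: forall_ord5; rewrite aform_frame_pt //=; move: realS;
  move: (face 0 \in S) (face 1 \in S) (face 2 \in S) (face 3 \in S)
        (face 4 \in S) => [] [] [] [] [] //= _; rewrite ?mulN1r ?mul1r; lra.
Qed.

End PyramidCells.

Lemma realizableP S : reflect (exists i, S = region_label i) (realizable S).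
Proof.
apply: (iffP idP) => [realS|[i ->]]; last first.
  rewrite /realizable !inE /=.
  by case: i; do 23?[case=> //].
(* Evaluation over all 32 membership patterns: 9 realizable ones contain the base plane and 14 do
   not. *)
have /hasP[s /(nthP [::])[i lti <-] /allP sS] : has (fun s =>
    all (fun k => (k.+1 \in s) == nth false [:: face 0 \in S; face 1 \in S;
      face 2 \in S; face 3 \in S; face 4 \in S] k) (iota 0 5)) region_strings.
  move: realS; rewrite /realizable.
  by move: (face 0 \in S) (face 1 \in S) (face 2 \in S) (face 3 \in S)
           (face 4 \in S) => [] [] [] [] [].
exists (Ordinal lti); apply/setP; apply: forall_ord5;
  by rewrite inE; apply/esym/eqP/sS.
Qed.

Lemma region_label_inj : injective region_label.
Proof.
move=> i j /setP ij; apply/val_inj/eqP.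
have : all (fun i => all (fun j => all (fun k =>
    (k.+1 \in nth [::] region_strings i) == (k.+1 \in nth [::] region_strings j))
    (iota 0 5) ==> (i == j)) (iota 0 23)) (iota 0 23) by [].
move=> /allP/(_ i); rewrite mem_iota ltn_ord => /(_ isT).
move=> /allP/(_ j); rewrite mem_iota ltn_ord => /(_ isT)/implyP; apply.
apply/allP => k; rewrite mem_iota => ltk5.
by have := ij (Ordinal ltk5); rewrite !inE => ->.
Qed.

Lemma card_region_labels i j :
  #|[set k | (k \in region_label i) (+) (k \in region_label j)]%SET| =
  hamming_label i j.
Proof.
rewrite /hamming_label -sum1_count -[iota 0 5]/(index_iota 0 5) big_mkord.
by rewrite -sum1_card; apply: eq_bigl => k; rewrite !inE.
Qed.

Theorem mainTheorem9 (R : realType) (v : 'I_4 -> 'rV[R]_3) (p : 'rV[R]_3) :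
  is_square_pyramid v p ->
  exists reg : 'I_23 -> set 'rV[R]_3,
    pyramid_regions v p reg /\
    is_smith_form (varchenko (pyramid_planes v p) reg) smith_diag
      left_transition right_transition.
Proof.
move=> /square_pyramid_frame[M M_unit [v0 v1 v2 v3]].
have vE (i : 'I_4) :
    v i = frame_pt p M [:: -1; 1; 1; -1]`_i [:: -1; -1; 1; 1]`_i 1.
  case: i => -[|[|[|[|//]]]] ? /=; rewrite -?v0 -?v1 -?v2 -?v3;
    by congr (v _); apply/val_inj.
pose reg i := cell (normal M) (offset p M) (region_label i).
have reg_neq0 i : reg i !=set0.
  by apply/(pcell_realizable p M_unit)/realizableP; exists i.
have real0 : realizable finset.set0 by rewrite /realizable !inE.
have cell0 := (pcell_realizable p M_unit _).2 real0.
exists reg; split.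
  rewrite /pyramid_regions (pyramid_planesE M_unit vE).
  rewrite (pyramid_interiorE M_unit vE) // regions_cells; split.
  - by exists finset.set0.
  - by move=> i j /(cell_inj (reg_neq0 i))/region_label_inj.
  - apply/seteqP; split=> [_ [i _ <-]|C [S S0 ->]].
      by exists (region_label i) => //; exact: reg_neq0.
    have /(pcell_realizable p M_unit)/realizableP[i ->] := S0.
    by exists i.
  - move=> i; rewrite (sep_cell (normal_neq0 M_unit) cell0 (reg_neq0 i)).
    by apply/setP => k; rewrite !inE.
(* From here on the matrix depends neither on the chosen pyramid nor on the field. *)
have -> : varchenko (pyramid_planes v p) reg = label_mx.
  apply/matrixP => i j; rewrite !mxE (pyramid_planesE M_unit vE).
  rewrite (sep_cell (normal_neq0 M_unit) (reg_neq0 i) (reg_neq0 j)).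
  by rewrite card_region_labels.
exact: label_mx_smith_form.
Qed.
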